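(* There is a $c>0$ and an $n_0$ such that for any $n>n_0$ the following is true. Let $S'$ be a string of length $n-1$ over the alphabet $\Sigma$, and let $S$ be a string obtained from $S'$ by adding a character to its beginning, chosen uniformly at random from the alphabet $\Sigma$. Then the expected growth $\mathbb{E}(\gamma(S))$ of $S$ is at least $c\cdot n$.
   Context: An alphabet $\Sigma$ is a set of different characters, and its size is denoted by $\sigma$. A string is over $\Sigma$ if each of its characters is in $\Sigma$. For a string $S$ of length $n$, $S[i]$ is its $i$th character, and $S[i,j]$ is the substring from $S[i]$ to $S[j]$ if $j \ge i$, and the empty string otherwise. The symbol $\$$ is not a character of $S$. The (non-compact, or simple) suffix tree of $S$ is the rooted tree, with edges directed from the root towards the leaves, with $n$ leaves numbered $1,\dots,n$, in which each edge is labelled by a single character (a character of $S$ or $\$$), the edges leaving a given node have different labels, and for each $j$ the concatenation of the edge labels along the path from the root to leaf $j$ is $S[j,n]$ followed by $\$$. The growth $\gamma(S)$ of $S$ is one less than the shortest distance (number of edges) to leaf $1$ from an internal node $v$ on the path from the root to leaf $1$ that has at least two children; that is, it counts the internal nodes different from $v$ on the path from $v$ to leaf $1$. For example, $\gamma(aabccb)=5$.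
   Formalization: The alphabet is assumed to have at least two characters; over a one-character alphabet the claim fails, since then S = aa...a has growth 1 for every n ≥ 2. *)

(* Defs.v *)
From HB Require Import structures.
From mathcomp Require Import all_boot all_order all_algebra.
From mathcomp Require Import reals.

Set Implicit Arguments.
Unset Strict Implicit.
Unset Printing Implicit Defensive.

Import GRing.Theory.

(* A finite directed graph with edges labelled in A, a distinguished root, and
   nodes [leaf 1], [leaf 2], ...; the numbering is 1-based, and only the
   numbers up to the number of leaves are meaningful. *)
Record ltree (A : eqType) := LTree {
  node :> finType;
  root : node;
  label : node -> node -> option A;
  leaf : nat -> node
}.

Section LabelledTrees.
Variables (A : eqType) (T : ltree A).
Implicit Types u v l : T.

Definition edge : rel T := fun u v => isSome (label u v).

Definition children u : {set T} := [set v | edge u v].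

Definition rooted_tree : Prop :=
  forall v, exists! p : seq T, path edge (root T) p && (last (root T) p == v).

Fixpoint spells u (w : seq A) v : bool :=
  if w is x :: w' then [exists u', (label u u' == Some x) && spells u' w' v]
  else u == v.

Fixpoint reach (k : nat) u v : bool :=
  if k is k'.+1 then [exists u', edge u u' && reach k' u' v] else u == v.

(* Equal to #|T| when v is not reachable from u. *)
Definition dist u v : nat := find (fun k => reach k u v) (iota 0 #|T|).

Definition on_root_path l v : bool :=
  connect edge (root T) v && connect edge v l.

(* If no node on the path branches, the minimum is the default value #|T|; in
   a suffix tree this happens only for strings of length at most 1. *)
Definition growth : nat :=
  (\big[minn/#|T|]_(v : T | on_root_path (leaf T 1) v && (1 < #|children v|))
     dist v (leaf T 1)).-1.

End LabelledTrees.

Section SuffixTree.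
Variable Sigma : finType.
Implicit Types (S : seq Sigma) (w t : seq (option Sigma)).

(* [None] plays the role of the terminator $. *)
Definition terminated S : seq (option Sigma) := rcons (map Some S) None.

(* S[j,n]$, with 1-based j *)
Definition suffix_from S (j : nat) : seq (option Sigma) :=
  terminated (drop j.-1 S).

Record is_suffix_tree S (T : ltree (option Sigma)) : Prop := IsSuffixTree {
  st_tree : rooted_tree T;
  st_leaf : forall j, 1 <= j <= size S -> children (leaf T j) = set0;
  st_leaf_inj : {in [pred j | 1 <= j <= size S] &, injective (leaf T)};
  st_leaf_surj : forall v : T, children v = set0 ->
    exists2 j, 1 <= j <= size S & leaf T j = v;
  st_label : forall (u v : T) x,
    label u v = Some x -> x \in None :: map Some S;
  st_det : forall (u v v' : T) x,
    label u v = Some x -> label u v' = Some x -> v = v';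
  st_spell : forall j, 1 <= j <= size S ->
    spells (root T) (suffix_from S j) (leaf T j)
}.

(* A node is identified with the word spelled on the path leading to it. *)
Definition st_words S : seq (seq (option Sigma)) :=
  [::] :: [seq take k (suffix_from S j) | j <- iota 1 (size S),
                                          k <- iota 0 (size S).+2].

Definition st_node S := seq_sub (st_words S).

Definition st_root S : st_node S := SeqSub (mem_head _ _).

Definition suffix_tree S : ltree (option Sigma) :=
  @LTree _ (st_node S) (st_root S)
    (fun u v => [pick x | val v == rcons (val u) x])
    (fun j => insubd (st_root S) (suffix_from S j)).

Lemma st_wordsP S w : 0 < size S ->
  reflect (exists2 j, 1 <= j <= size S & prefix w (suffix_from S j))
          (w \in st_words S).
Proof.
move=> S0; apply: (iffP idP).
- rewrite in_cons => /orP[/eqP->|/allpairsP[[j k] /= [+ _ ->]]].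
    by exists 1; rewrite ?S0 // prefix0s.
  rewrite mem_iota add1n ltnS => jS; exists j => //.
  exact: prefix_take.
- case=> j jS /prefixP[r Ew]; rewrite in_cons; apply/orP; right.
  apply/allpairsP; exists (j, size w); rewrite mem_iota add1n ltnS; split=> //.
    have := congr1 size Ew; rewrite /suffix_from /terminated size_rcons size_map.
    rewrite size_drop size_cat mem_iota add0n leq0n ltnS /= => sE.
    by apply: leq_trans (leq_addr (size r) _) _; rewrite -sE ltnS leq_subr.
  by rewrite Ew take_size_cat.
Qed.

Lemma st_words_prefix S w t : 0 < size S ->
  prefix w t -> t \in st_words S -> w \in st_words S.
Proof.
move=> S0 wt /(st_wordsP _ S0)[j jS tj]; apply/(st_wordsP _ S0); exists j => //.
exact: prefix_trans wt tj.
Qed.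

Lemma suffix_from_words S j :
  1 <= j <= size S -> suffix_from S j \in st_words S.
Proof.
move=> jS; have S0 : 0 < size S by case/andP: jS; apply: leq_trans.
by apply/(st_wordsP _ S0); exists j; rewrite ?prefix_refl.
Qed.

Lemma st_labelP S (u v : suffix_tree S) x :
  reflect (label u v = Some x) (val v == rcons (val u) x).
Proof.
apply: (iffP eqP) => [E|]; rewrite /label /=; case: pickP => //.
- by move=> y /eqP; rewrite E => /rcons_inj[->].
- by move=> /(_ x); rewrite E eqxx.
- by move=> y /eqP + [<-].
Qed.

Lemma st_edgeP S (u v : suffix_tree S) :
  reflect (exists x, val v = rcons (val u) x) (edge u v).
Proof.
rewrite /edge; apply: (iffP idP) => [|[x E]].
  case E: (label u v) => [x|] // _; exists x; exact/eqP/st_labelP.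
by move/eqP/st_labelP: E => ->.
Qed.

Lemma val_st_leaf S j : 1 <= j <= size S ->
  val (leaf (suffix_tree S) j : st_node S) = suffix_from S j.
Proof. by move=> jS; rewrite /= insubdK //; apply: suffix_from_words. Qed.

Lemma None_suffix_from S j w x t :
  suffix_from S j = rcons w x ++ t -> (x == None) = (t == [::]).
Proof.
rewrite /suffix_from /terminated; case/lastP: t => [|t y].
  by rewrite cats0 eqxx => /rcons_inj[_ <-].
rewrite -rcons_cat => /rcons_inj[E _]; rewrite -[RHS]size_eq0 size_rcons /=.
apply: contraTF isT => /eqP xN.
have : x \in map Some (drop j.-1 S) by rewrite E mem_cat mem_rcons mem_head.
by rewrite xN => /mapP[].
Qed.

Lemma suffix_treeP S : 0 < size S -> is_suffix_tree S (suffix_tree S).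
Proof.
move=> S0.
have node_of w : w \in st_words S -> {v : suffix_tree S | val v = w}.
  by move=> wS; exists (SeqSub wS).
split.
- move=> v.
  have [m] := ubnP (size (val v)); elim: m v => // m IHm v.
  case/lastP E: (val v) => [|w x] sv.
    have -> : v = root (suffix_tree S) by apply: val_inj.
    exists [::]; split=> [|p /andP[]]; first by rewrite /= eqxx.
    case/lastP: p => // p y; rewrite rcons_path last_rcons => /andP[_ e] /eqP yE.
    by move: e; rewrite yE => /st_edgeP[z] /(congr1 size); rewrite size_rcons.
  have wS : w \in st_words S.
    by apply: st_words_prefix S0 _ (valP v); rewrite E prefix_rcons.
  have [u uE] := node_of w wS.
  have [|p [/andP[pp /eqP pl] pU]] := IHm u.
    by move: sv; rewrite uE size_rcons ltnS.
  exists (rcons p v); split=> [|q /andP[]].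
    rewrite rcons_path last_rcons eqxx andbT pp pl.
    by apply/st_edgeP; exists x; rewrite uE.
  case/lastP: q => [_ /eqP /(congr1 val)|q y]; rewrite ?E.
    by move/(congr1 size); rewrite size_rcons.
  rewrite rcons_path last_rcons => /andP[qp /st_edgeP[z +]] /eqP yE.
  rewrite yE E => /rcons_inj[wE _]; rewrite (pU q) //.
  by rewrite qp /=; apply/eqP/val_inj; rewrite uE; exact: esym wE.
- move=> j jS; apply/setP=> v; rewrite !inE; apply/negbTE/negP=> /st_edgeP[x].
  rewrite val_st_leaf // /suffix_from /terminated => E.
  have /(st_wordsP _ S0)[i _ /prefixP[r]] := valP v.
  rewrite E cat_rcons => F.
  by have := None_suffix_from F; rewrite eqxx.
- move=> i j iS jS /(congr1 val); rewrite !val_st_leaf //.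
  move/(congr1 size); rewrite /suffix_from /terminated !size_rcons !size_map.
  rewrite !size_drop => -[E].
  move: iS jS; rewrite !inE; case: i j E => // i [] //= j E iS jS.
  by rewrite -(subKn (ltnW iS)) E subKn // ltnW.
- move=> v v0; have /(st_wordsP _ S0)[j jS /prefixP[[|x r] E]] := valP v.
    by exists j => //; apply: val_inj; rewrite val_st_leaf // E cats0.
  have wS : rcons (val v) x \in st_words S.
    apply/(st_wordsP _ S0); exists j => //.
    by rewrite E -cat_rcons prefix_prefix.
  have [u uE] := node_of _ wS.
  have : u \in children v by rewrite inE; apply/st_edgeP; exists x.
  by rewrite v0 inE.
- move=> u v x /st_labelP/eqP E.
  have /(st_wordsP _ S0)[j _ /prefixP[r F]] := valP v.
  have : x \in suffix_from S j by rewrite F E mem_cat mem_rcons mem_head.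
  rewrite /suffix_from /terminated mem_rcons !in_cons => /orP[->//|].
  by case/mapP=> a aS ->; apply/orP; right; rewrite mem_map ?(mem_drop aS) //; apply: Some_inj.
- by move=> u v v' x /st_labelP/eqP E /st_labelP/eqP E'; apply: val_inj; rewrite E E'.
- move=> j jS.
  have spE w : forall u v : suffix_tree S, val v = val u ++ w -> spells u w v.
    elim: w => [|x w IHw] u v E /=; first by rewrite (val_inj (esym (etrans E (cats0 _)))).
    have uS : rcons (val u) x \in st_words S.
      by apply: st_words_prefix S0 _ (valP v); rewrite E -cat_rcons prefix_prefix.
    have [u' u'E] := node_of _ uS.
    apply/existsP; exists u'; apply/andP; split; first by apply/eqP/st_labelP/eqP.
    by apply: IHw; rewrite u'E cat_rcons.
  by apply: spE; rewrite val_st_leaf.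
Qed.

Definition gamma S : nat := growth (suffix_tree S).

End SuffixTree.

Definition unif_expectation (R : realType) (T : finType) (f : T -> R) : R :=
  (\sum_(x : T) #|T|%:R^-1 * f x)%R.

(* Main.v *)
Require Import Defs.
From HB Require Import structures.
From mathcomp Require Import all_boot all_order all_algebra.
From mathcomp Require Import reals.
From mathcomp Require Import zify lra.

(** The depth of a branching node on the path to leaf 1 is the length of a
    prefix of [S] that occurs a second time in [S], because two different
    continuations of a word come from two different suffixes
    ([branching_repeats]).  Hence, if the growth of [S] is less than half of
    [size S], some prefix longer than half of [S] occurs again, at an offset
    that is less than half of [size S] ([small_gamma_repeats]).

    This can happen for only one first character.  Let [x :: t] and [y :: t]
    have such repetitions, at offsets [p] and [q].  Both strings agree with [t]
    at positive positions, so the character at position [p + q] is the one at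
    position [p] (by the repetition in [y :: t]), which is [x], and also the one
    at position [q] (by the repetition in [x :: t]), which is [y]
    ([repeats_head_inj]).  Therefore all characters of the alphabet, except at most one,
    give growth at least half of the length, and since there are at least two
    characters, the expected growth is at least a quarter of the length. *)

Set Implicit Arguments.
Unset Strict Implicit.
Unset Printing Implicit Defensive.

Definition repeats (A : eqType) (s : seq A) (k p : nat) : Prop :=
  [/\ 0 < p, p + k <= size s & take k (drop p s) = take k s].

Lemma repeats_nth (A : eqType) (s : seq A) k p x0 i :
  repeats s k p -> i < k -> nth x0 s (p + i) = nth x0 s i.
Proof. by case=> _ _ E ik; rewrite -nth_drop -(nth_take x0 ik) E nth_take. Qed.

(** The commutation [p + q = q + p] makes the two repetitions meet; the bounds
    say that each offset lies inside the other repeated prefix. *)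
Lemma repeats_head_inj (A : eqType) (t : seq A) x y k p m q :
  repeats (x :: t) k p -> repeats (y :: t) m q -> p < m -> q < k -> x = y.
Proof.
move=> rx ry pm qk; have [p0 _ _] := rx; have [q0 _ _] := ry.
have tl i : 0 < i -> nth x (x :: t) i = nth x (y :: t) i by case: i.
have <- : nth x (x :: t) p = x.
  by rewrite -[p]addn0 (repeats_nth x rx) //; apply: leq_trans qk.
have <- : nth x (y :: t) q = y.
  by rewrite -[q]addn0 (repeats_nth x ry) //; apply: leq_trans pm.
rewrite (tl p) // -(repeats_nth x ry) // addnC -(tl (p + q)) ?addn_gt0 ?p0 //.
by rewrite (repeats_nth x rx) // tl.
Qed.

(** The terminator occurs only at the end, so a word with a continuation does
    not contain it. *)
Lemma map_Some_prefix (A : eqType) (s : seq A) w x :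
  prefix (rcons w x) (rcons (map Some s) None) -> w = map Some (take (size w) s).
Proof.
case/prefixP=> r; case/lastP: r => [|r y].
  by rewrite cats0 => /rcons_inj[<- _]; rewrite size_map take_size.
rewrite -rcons_cat => /rcons_inj[E _].
by rewrite map_take E -cats1 -catA take_size_cat.
Qed.

Section SuffixTreeDepth.
Variables (Sigma : finType) (S : seq Sigma).
Implicit Types u v : suffix_tree S.

Lemma reach_size k u v : reach k u v -> size (val v) = k + size (val u).
Proof.
elim: k u => [|k IHk] u /=; first by move/eqP->.
case/existsP=> u' /andP[/st_edgeP[x E] /IHk ->].
by rewrite E size_rcons addnS.
Qed.

Lemma connect_prefix u v : connect (@edge _ (suffix_tree S)) u v -> prefix (val u) (val v).
Proof.
case/connectP=> p + ->; elim: p u => [|w p IHp] u /=; first by rewrite prefix_refl.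
case/andP=> /st_edgeP[x E] /IHp; apply: prefix_trans.
by rewrite E prefix_rcons.
Qed.

Lemma card_suffix_tree : size S <= #|suffix_tree S|.
Proof.
have [->|S0] := posnP (size S); first by [].
rewrite -[size S]card_ord.
apply: (@leq_card _ _ (fun i : 'I_(size S) => leaf (suffix_tree S) i.+1)).
move=> i j /(st_leaf_inj (suffix_treeP S0)) E; apply: val_inj.
by apply: succn_inj; apply: E; rewrite inE /= ltn_ord.
Qed.

(** [dist] takes the value [#|suffix_tree S|] on unreachable nodes, which is why
    the bound is truncated at [size S]. *)
Lemma dist_leaf1_ge v : 0 < size S ->
  minn (size S) ((size S).+1 - size (val v)) <= dist v (leaf (suffix_tree S) 1).
Proof.
move=> S0; have [hs|hs] := ltnP (dist v (leaf (suffix_tree S) 1)) #|suffix_tree S|; last first.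
  by apply: leq_trans (geq_minl _ _) _; apply: leq_trans card_suffix_tree hs.
have : has (fun k => reach k v (leaf (suffix_tree S) 1)) (iota 0 #|suffix_tree S|).
  by rewrite has_find size_iota.
move/(nth_find 0); rewrite nth_iota // add0n => /reach_size.
rewrite val_st_leaf ?S0 // /suffix_from /terminated drop0 size_rcons size_map /dist.
by move=> ->; rewrite addnK geq_minr.
Qed.

(** Two different continuations cannot both come from the suffix [S] itself, so
    one of them comes from a proper suffix. *)
Lemma branching_repeats v : 0 < size S ->
  on_root_path (leaf (suffix_tree S) 1) v -> 1 < #|children v| ->
  exists p, repeats S (size (val v)) p.
Proof.
move=> S0 /andP[_ /connect_prefix]; rewrite val_st_leaf ?S0 //.
set w := val v => wS /card_gt1P[u1 [u2 [+ + u12]]].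
rewrite !inE => /st_edgeP[x1 E1] /st_edgeP[x2 E2].
have /(st_wordsP _ S0)[j1 j1S] := valP u1; rewrite E1 -/w => P1.
have /(st_wordsP _ S0)[j2 j2S] := valP u2; rewrite E2 -/w => P2.
have [j [x [jS jgt1 Pj]]] : exists j x,
    [/\ 1 <= j <= size S, 1 < j & prefix (rcons w x) (suffix_from S j)].
  have [?|j1le] := ltnP 1 j1; first by exists j1, x1.
  have [?|j2le] := ltnP 1 j2; first by exists j2, x2.
  have j12 : j1 = j2 by lia.
  move: P1 P2; rewrite j12 !prefixE !size_rcons => /eqP -> /eqP E.
  by case/eqP: u12; apply: val_inj; rewrite E1 E2.
have W : w = map Some (take (size w) (drop j.-1 S)) by exact: map_Some_prefix Pj.
have sw : size w <= size S - j.-1.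
  by rewrite W size_map size_take size_drop -/(minn _ _) geq_minr.
have wk : size w <= size S by apply: leq_trans sw (leq_subr _ _).
have jle : j.-1 <= size S by lia.
exists j.-1; split; first by lia.
  by rewrite -leq_subRL.
have SomeI : injective (@Some Sigma) by move=> a b [].
apply: (inj_map SomeI); rewrite -W.
move: wS; rewrite prefixE /suffix_from /terminated drop0 => /eqP {1}<-.
by rewrite -cats1 takel_cat ?size_map // map_take.
Qed.

(** In the suffix tree the node [v] has distance [(size S).+1 - size (val v)]
    to leaf 1, so a branching node within distance [uphalf (size S)] of it is
    deeper than half of [size S]. *)
Lemma small_gamma_repeats : 1 < size S -> (gamma S).*2 < size S ->
  exists k p, size S < k.*2 /\ repeats S k p.
Proof.
move=> S1; have S0 : 0 < size S by apply: ltnW.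
case: (pickP (fun v : suffix_tree S =>
  [&& on_root_path (leaf (suffix_tree S) 1) v, 1 < #|children v|
     & size S < (size (val v)).*2])) => [v /and3P[rv cv kv] _|short].
  by have [p rp] := branching_repeats S0 rv cv; exists (size (val v)), p.
suff : uphalf (size S) < (gamma S).+1 by lia.
rewrite /gamma /growth; set m := \big[_/_]_(_ | _) _.
suff : uphalf (size S) < m by lia.
rewrite {}/m; elim/big_ind: _.
- by apply: leq_trans card_suffix_tree; lia.
- by move=> a b ha hb; rewrite leq_min ha.
- move=> v /andP[rv cv]; apply: leq_trans (dist_leaf1_ge v S0).
  by have := short v; rewrite rv cv /=; lia.
Qed.

End SuffixTreeDepth.

Lemma small_gamma_head_inj (Sigma : finType) (t : seq Sigma) x y : 0 < size t ->
  (gamma (x :: t)).*2 < (size t).+1 -> (gamma (y :: t)).*2 < (size t).+1 -> x = y.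
Proof.
move=> t0 gx gy.
have [k [p [kp rx]]] := @small_gamma_repeats _ (x :: t) t0 gx.
have [m [q [mq ry]]] := @small_gamma_repeats _ (y :: t) t0 gy.
case: (rx) (ry) => /= _ px _ [/= _ qy _]; move: kp mq => /= kp mq.
by apply: (repeats_head_inj rx ry); lia.
Qed.

Import Order.TTheory GRing.Theory Num.Theory.

Section UniformExpectation.
Local Open Scope ring_scope.

(** The exceptional element has probability at most one half, and it
    contributes at least zero. *)
Lemma unif_expectation_ge_half (R : realType) (T : finType) (f : T -> R) (a : R) :
  (1 < #|T|)%N -> 0 <= a -> (forall x, 0 <= f x) ->
  (forall x y, f x < a -> f y < a -> x = y) -> a / 2 <= unif_expectation f.
Proof.
move=> T1 a0 f0 fa.
have [x0 fx0] : exists x0, forall x, x != x0 -> a <= f x.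
  case: (pickP (fun x => f x < a)) => [x0 fx0|nf].
    exists x0 => x; apply: contraNle => fx; apply/eqP; exact: fa.
  have /card_gt0P[x0 _] : (0 < #|T|)%N by apply: ltnW.
  by exists x0 => x _; rewrite leNgt nf.
rewrite /unif_expectation -mulr_sumr (bigD1 x0) //=.
have rest : a *+ #|T|.-1 <= \sum_(x | x != x0) f x.
  rewrite -(cardC1 x0) -sumr_const; apply: ler_sum => x; exact: fx0.
have T0 : 0 < #|T|%:R :> R by rewrite ltr0n ltnW.
rewrite ler_pdivlMl //; apply: le_trans (lerD (f0 x0) rest).
rewrite add0r -[a *+ _]mulr_natl.
have -> : #|T|%:R = 1 + #|T|.-1%:R :> R by rewrite nat1r prednK // ltnW.
have : 1 <= #|T|.-1%:R :> R by rewrite ler1n; lia.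
nra.
Qed.

End UniformExpectation.

Theorem theorem12 (R : realType) :
  exists (c : R) (n0 : nat), (0 < c)%R /\
    forall n : nat, n0 < n ->
    forall Sigma : finType, 1 < #|Sigma| ->
    forall S' : (n - 1).-tuple Sigma,
      (c * n%:R <= unif_expectation (fun x : Sigma => (gamma (x :: S'))%:R : R))%R.
Proof.
exists (1 / 4)%R, 1; split=> [|n n1 Sigma Sigma1 S']; first by lra.
have -> : (1 / 4 * n%:R = (n%:R / 2) / 2 :> R)%R by lra.
have small x : ((gamma (x :: S'))%:R < n%:R / 2 :> R)%R ->
    (gamma (x :: S')).*2 < (size S').+1.
  rewrite ltr_pdivlMr // -natrM ltr_nat size_tuple; lia.
apply: unif_expectation_ge_half => //; first by rewrite divr_ge0 ?ler0n.
move=> x y /small gx /small gy.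
by apply: small_gamma_head_inj gx gy; rewrite size_tuple; lia.
Qed.
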